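(* Let $k\ge1$ and $n$ be integers with $2k+1\le n$, let $m=n-k$, and let $\pi_{n,k}:=[1,\ldots,k,\,n-k,\,n-k-1,\ldots,k+1]\in\mathfrak{S}_{m}$. Identify the diagonal $\overline{ij}\in\Gamma_{n,k}$ ($i<j$) with the box in row $a=n+1-j$ and column $b=i$ of the staircase $\{(a,b): a,b\ge1,\ a+b\le m\}$; this identifies $\Gamma_{n,k}$ with the set of boxes $(a,b)$ with $k+2\le a+b\le m$. Then the map sending a $k$-triangulation $T$ of the $n$-gon to the pipe dream of size $m$ whose crossing tiles are exactly the boxes corresponding to the diagonals in $\Gamma_{n,k}\setminus T$ (all other boxes, i.e. those corresponding to diagonals of $T$ and those with $a+b\le k+1$, being elbow tiles) is a bijection between $k$-triangulations of the $n$-gon and reduced pipe dreams for $\pi_{n,k}$.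
   Context: Label the vertices of a convex $n$-gon by $1,\ldots,n$ in cyclic order, and write $\overline{ij}$ for the segment joining $i$ and $j$. Set $\Gamma_{n,k}:=\{\overline{ij}: k<|i-j|<n-k\}$. A $(k+1)$-crossing is a set of $k+1$ diagonals which mutually cross. A $k$-triangulation is a maximal subset of $\Gamma_{n,k}$ containing no $(k+1)$-crossing. A pipe dream of size $m$ is a filling of each box $(a,b)$ (row $a$ from the top, column $b$ from the left) of the staircase $\{(a,b):a,b\ge1, a+b\le m\}$ with either a crossing tile (two pipes crossing) or an elbow tile (two turning pipes, one connecting the top to the left edge, one connecting the bottom to the right edge), with an elbow half-tile joining the right and bottom edges of each position $(a,b)$ with $a+b=m+1$. Pipes enter at the top of the columns $1,\ldots,m$ and exit at the left of the rows $1,\ldots,m$; the permutation $\pi(D)$ of the pipe dream $D$ is read off by recording at the left end of each row the column number where the pipe ending there entered, and reading these labels from top to bottom. $D$ is reduced if any two pipes cross at most once. A reduced pipe dream for $\pi$ is a reduced pipe dream $D$ with $\pi(D)=\pi$. *)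

(* Defs.v *)
From mathcomp Require Import all_boot.
Set Implicit Arguments. Unset Strict Implicit. Unset Printing Implicit Defensive.

(* Vertices of the n-gon are 1..n; a diagonal (i,j) is stored with i < j.
   Sets of diagonals are finite sets of pairs in 'I_n.+1 * 'I_n.+1 (values
   0..n; only pairs satisfying in_Gamma are relevant). *)

Definition in_Gamma (n k : nat) (d : nat * nat) : bool :=
  let: (i, j) := d in
  [&& 1 <= i, i < j, j <= n, k < j - i & j - i < n - k].

Definition dval n (e : 'I_n.+1 * 'I_n.+1) : nat * nat := (val e.1, val e.2).

Definition Gamma (n k : nat) : {set 'I_n.+1 * 'I_n.+1} :=
  [set e | in_Gamma n k (dval e)].

Definition cross (d d' : nat * nat) : bool :=
  let: (i, j) := d in let: (i', j') := d' in
  [&& i < i', i' < j & j < j'] || [&& i' < i, i < j' & j' < j].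

Definition is_crossing n (l : nat) (S : {set 'I_n.+1 * 'I_n.+1}) : Prop :=
  #|S| = l /\ (forall d d', d \in S -> d' \in S -> d != d' -> cross (dval d) (dval d')).

Definition crossing_free n (k : nat) (T : {set 'I_n.+1 * 'I_n.+1}) : Prop :=
  forall S : {set 'I_n.+1 * 'I_n.+1}, S \subset T -> ~ is_crossing k.+1 S.

Definition k_triangulation (n k : nat) (T : {set 'I_n.+1 * 'I_n.+1}) : Prop :=
  [/\ T \subset Gamma n k, crossing_free k T &
      forall T' : {set 'I_n.+1 * 'I_n.+1}, T \subset T' -> T' \subset Gamma n k -> crossing_free k T' -> T' = T].

(* A pipe dream of size m is given by its set of crossing tiles, a subset of
   the staircase {(a,b) : a,b >= 1, a+b <= m}; every other box of the
   staircase is an elbow tile, and positions with a+b = m+1 are elbow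
   half-tiles (a pipe entering from the top leaves to the left). *)

Definition in_staircase (m a b : nat) : bool := [&& 1 <= a, 1 <= b & a + b <= m].

Definition staircase (m : nat) : {set 'I_m.+1 * 'I_m.+1} :=
  [set x : 'I_m.+1 * 'I_m.+1 | in_staircase m x.1 x.2].

Definition is_cross m (D : {set 'I_m.+1 * 'I_m.+1}) (a b : nat) : bool :=
  (a + b <= m) && [exists x in D, (val x.1 == a) && (val x.2 == b)].

(* Trace a pipe: it is in box (a,b), having entered from the top (top=true)
   or from the right (top=false). Returns the list of visited positions and
   the row at whose left end it exits (0 if fuel runs out). *)
Fixpoint trace m (D : {set 'I_m.+1 * 'I_m.+1}) (fuel a b : nat) (top : bool)
  : seq (nat * nat) * nat :=
  match fuel with
  | 0 => ([::], 0)
  | f.+1 =>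
    let c := is_cross D a b in
    let down := if top then c else ~~ c in
    let rest :=
      if down then trace D f a.+1 b true
      else if b <= 1 then ([::], a) else trace D f a b.-1 false in
    ((a, b) :: rest.1, rest.2)
  end.

Definition pipe m (D : {set 'I_m.+1 * 'I_m.+1}) (c : nat) :=
  trace D (2 * m + 2) 1 c true.

(* pi(D) = p (one-line notation p(1), ..., p(m)): the label recorded at the
   left end of row a is p a, i.e. the pipe entering in column c exits at
   row a iff p a = c. *)
Definition has_perm m (D : {set 'I_m.+1 * 'I_m.+1}) (p : nat -> nat) : Prop :=
  forall a c, 1 <= a <= m -> 1 <= c <= m -> ((pipe D c).2 = a <-> p a = c).

Definition reduced m (D : {set 'I_m.+1 * 'I_m.+1}) : Prop :=
  forall c1 c2, 1 <= c1 <= m -> 1 <= c2 <= m -> c1 != c2 ->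
    count (fun x => is_cross D x.1 x.2 && (x \in (pipe D c2).1)) (pipe D c1).1 <= 1.

Definition reduced_pipe_dream_for m (D : {set 'I_m.+1 * 'I_m.+1}) (p : nat -> nat)
  : Prop := [/\ D \subset staircase m, reduced D & has_perm D p].

Definition pi_nk (n k : nat) (a : nat) : nat := if a <= k then a else n.+1 - a.

Definition box_diag (n a b : nat) : nat * nat := (b, n.+1 - a).

Definition in_T n (T : {set 'I_n.+1 * 'I_n.+1}) (d : nat * nat) : bool :=
  [exists e in T, dval e == d].

Definition phi (n k : nat) (T : {set 'I_n.+1 * 'I_n.+1})
  : {set 'I_(n - k).+1 * 'I_(n - k).+1} :=
  [set x : 'I_(n - k).+1 * 'I_(n - k).+1 | [&& in_staircase (n - k) x.1 x.2,
               in_Gamma n k (box_diag n x.1 x.2) &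
               ~~ in_T T (box_diag n x.1 x.2)]].

Arguments k_triangulation n k T : clear implicits.
Arguments phi n k T : clear implicits.

(* Main.v *)
Require Import Defs.
From mathcomp Require Import all_boot zify.
Set Implicit Arguments. Unset Strict Implicit. Unset Printing Implicit Defensive.

(* Sweep the boxes row by row, from right to left: a crossing tile in box (a,b)
   exchanges the pipes at positions a+b-1 and a+b of the boundary of the swept
   region.  Ignoring the crossings between pipes that have already crossed
   (Demazure product) leaves a reduced pipe dream, and the number H(i) of pipes
   with label <= q among the first i positions then evolves, at any crossing
   tile, by H(i) := max(H(i-1), H(i+1)-1).  The length of a longest chain of
   elbows going strictly north-east satisfies the same recursion, so the number
   of pipes <= q leaving through the first p rows is the maximal length of such
   a chain in [p] x [q].  A (k+1)-crossing is exactly a chain of k+1 boxes with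
   p+q <= n; hence having no (k+1)-crossing of elbows means that at most k pipes
   <= q leave through the first p rows whenever p+q = n.  As the pipes 1..k go
   straight to the rows 1..k, this forces the permutation to be pi_{n,k}, so the
   crossing tiles of the complement of any crossing-free set contain a reduced
   pipe dream for pi_{n,k}.  Finally, two nested reduced pipe dreams for the same
   permutation agree, because H is antitone in the set of crossing tiles. *)

Definition adj (k x : nat) : nat :=
  if x == k then k.+1 else if x == k.+1 then k else x.

Lemma adjK k : involutive (adj k).
Proof. by move=> x; rewrite /adj; repeat case: ifP; lia. Qed.

Lemma adj_lt k i j :
  i < j -> (i != k) || (j != k.+1) -> adj k i < adj k j.
Proof. by rewrite /adj; repeat case: ifP; lia. Qed.

(** * Sequences of adjacent exchanges *)

Section Words.
Variable idx : nat -> nat.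
Implicit Types (c : nat -> bool) (t q i j : nat) (s : nat -> nat).

(* [run c t i] is the label at position [i] at time [t]. *)
Fixpoint run c t : nat -> nat :=
  if t is t'.+1 then
    if c t' then run c t' \o adj (idx t') else run c t'
  else id.

Lemma run_eq c c' t : c =1 c' -> run c t = run c' t.
Proof. by move=> e; elim: t => //= t ->; rewrite e. Qed.

Lemma run_inj c t : injective (run c t).
Proof.
elim: t => //= t IH; case: (c t) => // x y /= /IH.
exact: (can_inj (@adjK _)).
Qed.

Lemma run_frame c t1 t2 i : t1 <= t2 ->
  (forall t, t1 <= t < t2 -> c t -> (i != idx t) && (i != (idx t).+1)) ->
  run c t2 i = run c t1 i.
Proof.
move=> le12; rewrite -(subnKC le12); elim: (t2 - t1) => [|d IH] H.
  by rewrite addn0.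
rewrite addnS /= -IH; last by move=> t Ht; apply: H; lia.
case: ifP => //= ct; have := H (t1 + d); rewrite ct.
move=> /(_ ltac:(lia) isT) /andP[n1 n2].
by rewrite /adj (negbTE n1) (negbTE n2).
Qed.

Definition sorted_run c := forall t, c t -> run c t (idx t) < run c t (idx t).+1.

(* [c'] selects the exchanges of [c] at which the two labels are still in
   increasing order, i.e. have not been exchanged before. *)
Definition demazure c c' :=
  forall t, c' t = c t && (run c' t (idx t) < run c' t (idx t).+1).

(** Carrying the labels along resolves the circularity in [demazure], where the selection at time
    [t] depends on the run of the selection itself. *)
Fixpoint dem_run c t : nat -> nat :=
  if t is t'.+1 then
    let s := dem_run c t' in
    if c t' && (s (idx t') < s (idx t').+1) then s \o adj (idx t') else s
  else id.

Definition dem c t := c t && (dem_run c t (idx t) < dem_run c t (idx t).+1).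

Lemma dem_demazure c : demazure c (dem c).
Proof.
suff E t : run (dem c) t = dem_run c t by move=> t; rewrite E.
by elim: t => //= t ->.
Qed.

Lemma demazure_sorted c c' : demazure c c' -> sorted_run c'.
Proof. by move=> H t; rewrite H => /andP[]. Qed.

Lemma sorted_demazure c : sorted_run c -> demazure c c.
Proof. by move=> H t; case ct: (c t) => //; rewrite (H t ct). Qed.

(** Followed backwards in time, the two positions keep their order until a step that exchanges
    exactly these two; at time 0 nothing is inverted. *)
Lemma inverted_met c t i j : i < j -> run c t j < run c t i ->
  exists2 t0, t0 < t & c t0 /\
    [\/ run c t0 (idx t0) = run c t i /\ run c t0 (idx t0).+1 = run c t j
      | run c t0 (idx t0) = run c t j /\ run c t0 (idx t0).+1 = run c t i].
Proof.
elim: t i j => [|t IH] i j ij /=; first by lia.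
case ct: (c t) => /= inv; last first.
  by case: (IH i j ij inv) => t0 lt0 H; exists t0 => //; apply: leqW.
have [/andP[/eqP ei /eqP ej]|] := boolP ((i == idx t) && (j == (idx t).+1)).
  by exists t => //; split=> //; right; rewrite ei ej /adj !eqxx; case: eqP => //; lia.
rewrite negb_and => /(adj_lt ij) lt_ij.
by case: (IH _ _ lt_ij inv) => t0 lt0 H; exists t0 => //; apply: leqW.
Qed.

(** A sorted run only exchanges increasing neighbours, so a pair once inverted is never exchanged
    back. *)
Lemma inverted_stays c t t' i j : sorted_run c -> t <= t' ->
  i < j -> run c t j < run c t i ->
  exists i' j', [/\ i' < j', run c t' i' = run c t i & run c t' j' = run c t j].
Proof.
move=> sc le_t ij inv; rewrite -(subnKC le_t).
elim: (t' - t) => [|d [i' [j' [ij' ei ej]]]]; first by exists i, j; rewrite addn0.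
rewrite addnS /=; case: ifP => [cd|_]; last by exists i', j'.
exists (adj (idx (t + d)) i'), (adj (idx (t + d)) j').
rewrite /= !adjK; split=> //; apply: adj_lt => //; rewrite -negb_and.
apply/negP => /andP[/eqP e1 /eqP e2]; have := sc _ cd.
by rewrite -e2 -e1 ei ej; lia.
Qed.

(** * Heights: prefix counts of small labels *)

Definition cnt q s i := \sum_(1 <= l < i.+1) (s l <= q).

Lemma cnt0 q s : cnt q s 0 = 0.
Proof. by rewrite /cnt big_geq. Qed.

Lemma cntS q s i : cnt q s i.+1 = cnt q s i + (s i.+1 <= q).
Proof. by rewrite /cnt big_nat_recr. Qed.

Lemma eq_cnt q s s' i : (forall l, 1 <= l <= i -> s l = s' l) -> cnt q s i = cnt q s' i.
Proof. by move=> e; apply: eq_big_nat => l Hl; rewrite e //; lia. Qed.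

Lemma cnt_id q i : cnt q id i = minn i q.
Proof. by elim: i => [|i IH]; rewrite ?cnt0 ?cntS ?IH; lia. Qed.

Lemma cnt_adj q s k i : 0 < k ->
  cnt q (s \o adj k) i = if i == k then cnt q s k.-1 + (s k.+1 <= q) else cnt q s i.
Proof.
case: k => // k _; elim: i => [|i IH]; first by rewrite !cnt0.
rewrite cntS IH /= /adj eqSS.
have [-> | nik] := eqVneq i k.
  by rewrite (_ : k == k.+1 = false) //; lia.
have [-> | nik1] := eqVneq i k.+1.
  by rewrite !eqxx !cntS; lia.
by rewrite eqSS (negbTE nik1) cntS.
Qed.

Hypothesis idx_gt0 : forall t, 0 < idx t.

(* The right-hand side depends on [c'] only through the heights: a skipped
   exchange of [c] acts on them as a performed one. *)
Lemma cnt_run_step c c' q t j : demazure c c' ->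
  cnt q (run c' t.+1) j =
    if c t && (j == idx t)
    then maxn (cnt q (run c' t) j.-1) (cnt q (run c' t) j.+1).-1
    else cnt q (run c' t) j.
Proof.
move=> dc /=; have := dc t; case: (c t) => /= ->; last by [].
set s := run c' t; have i0 := idx_gt0 t.
case: ifP => lt; rewrite ?cnt_adj //; have [-> | //] := eqVneq j (idx t).
all: move: lt; case: (idx t) i0 => // i _ /=; rewrite !cntS; lia.
Qed.

Lemma cnt_run_frame c c' q t1 t2 i : demazure c c' -> t1 <= t2 ->
  (forall t, t1 <= t < t2 -> c t -> i != idx t) ->
  cnt q (run c' t2) i = cnt q (run c' t1) i.
Proof.
move=> dc le12; rewrite -(subnKC le12); elim: (t2 - t1) => [|d IH] H.
  by rewrite addn0.
rewrite addnS (cnt_run_step _ _ _ dc) -IH; last by move=> t Ht; apply: H; lia.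
case: ifP => // /andP[ct /eqP e]; have := H (t1 + d).
by rewrite ct -e eqxx => /(_ ltac:(lia) isT).
Qed.

(** The update is monotone in the heights, and max(H(i-1), H(i+1)-1) <= H(i) covers a step made by
    [c2] alone. *)
Lemma cnt_run_mono c1 c1' c2 c2' q t j :
  demazure c1 c1' -> demazure c2 c2' -> (forall t, c1 t -> c2 t) ->
  cnt q (run c2' t) j <= cnt q (run c1' t) j.
Proof.
move=> d1 d2 sub; elim: t j => // t IH j.
rewrite (cnt_run_step _ _ _ d1) (cnt_run_step _ _ _ d2).
have [ej|] := eqVneq j (idx t); last by rewrite !andbF.
have := sub t; case: (c1 t) => [/(_ isT) ->|_] /=.
  by have := IH j.-1; have := IH j.+1; lia.
case: (c2 t) => //=; have := IH j; have := idx_gt0 t.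
by rewrite -ej; case: j {ej} => // j _ /=; rewrite !cntS; lia.
Qed.

Lemma sorted_run_unique c1 c2 N : sorted_run c1 -> sorted_run c2 ->
  (forall t, c1 t -> c2 t) -> run c1 N =1 run c2 N ->
  forall t, t < N -> c1 t = c2 t.
Proof.
move=> s1 s2 sub; elim: N => // N IH eN.
have cN : c1 N = c2 N.
  move: (sub N) eN => /=; case E1: (c1 N); first by move=> ->.
  case E2: (c2 N) => // _ eN.
  (* If only [c2] exchanges at time [N], the threshold label [run c2 N (idx N)] is among the first
     [idx N] labels for [c2], while [c1] has a larger label in its place; this contradicts the
     antitone heights. *)
  have := cnt_run_mono (run c2 N (idx N)) N (idx N)
    (sorted_demazure s1) (sorted_demazure s2) sub.
  have /eq_cnt -> : forall l, 1 <= l <= idx N ->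
    run c1 N l = (run c2 N \o adj (idx N)) l by move=> l _; rewrite eN.
  rewrite cnt_adj // eqxx; have := s2 _ E2; have := idx_gt0 N.
  case: (idx N) => // i _ /=; rewrite cntS; lia.
move=> t; rewrite ltnS leq_eqVlt => /orP[/eqP->//|]; apply: IH => x.
move: eN => /=; rewrite cN; case: (c2 N) => // eN.
by have := eN (adj (idx N) x); rewrite /= adjK.
Qed.

End Words.

(** * Chains of elbows *)

(* Boxes are (row, column) with rows counted downwards, so [ne x y] says that
   [y] lies strictly north-east of [x]. *)
Definition ne (x y : nat * nat) : bool := (y.1 < x.1) && (x.2 < y.2).

Lemma ne_trans : transitive ne.
Proof. by move=> y x z /andP[? ?] /andP[? ?]; apply/andP; lia. Qed.

Section Chains.
Variables (m q : nat) (cr : nat -> nat -> bool) (h : nat -> nat -> nat).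
Hypothesis q_le_m : q <= m.
Hypothesis h0 : forall b, h 0 b = minn b q.
Hypothesis hm : forall a, h a m = q.
Hypothesis hS : forall a b, b < m ->
  h a.+1 b = if cr a.+1 b.+1 then maxn (h a b) (h a.+1 b.+1).-1 else h a b.+1.

(* The two lemmas below show that [h a b - b] is the maximal length of a chain
   of elbows in the rows [1..a] and the columns [b+1..q]. *)
Definition elbow_in a b (x : nat * nat) : bool :=
  [&& 0 < x.1 <= a, b < x.2 <= q & ~~ cr x.1 x.2].

Lemma h_right a b : q <= b <= m -> h a b = q.
Proof.
elim: a b => [|a IH] b; first by rewrite h0; lia.
case/andP => qb bm; rewrite -(subKn bm) in qb *.
elim: (m - b) qb => [|d IHd] qb; first by rewrite subn0 hm.
(* For [d >= m] truncated subtraction makes [m - d.+1] equal to [m - d], so the previous case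
   applies. *)
have [lt|le] := ltnP d m; last first.
  by rewrite (_ : m - d.+1 = m - d) in qb *; [apply: IHd|lia].
rewrite hS; last by lia.
rewrite (_ : (m - d.+1).+1 = m - d); last by lia.
by rewrite IHd ?IH ?maxnn; try case: ifP; lia.
Qed.

Lemma chain_le a b l : b <= q ->
  sorted ne l -> all (elbow_in a b) l -> b + size l <= h a b.
Proof.
elim: a b l => [|a IHa] b l.
  case: l => [|x l] bq _; first by rewrite h0 /=; lia.
  by case/andP; rewrite /elbow_in; lia.
move=> bq; rewrite -(subKn bq); elim: (q - b) l => [|d IHd] l sl al.
  rewrite subn0 h_right; last by lia.
  case: l sl al => [|x l] _; first by rewrite /=; lia.
  by case/andP; rewrite /elbow_in; lia.
have [lt|le] := ltnP d q; last first.
  rewrite (_ : q - d.+1 = q - d) in al *; last by lia.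
  by apply: IHd => //; lia.
set b' := q - d.+1 in al *; have eb : q - d = b'.+1 by lia.
rewrite eb in IHd; rewrite hS; last by lia.
case: l sl al => [|x l] sl.
  move=> _; have := IHa b'.+1 [::] ltac:(lia) isT isT.
  have := IHa b' [::] ltac:(lia) isT isT.
  by case: ifP; rewrite /=; lia.
move=> /andP[ex al].
have sub : all (ne x) l by apply: order_path_min sl; exact: ne_trans.
have sl' := path_sorted sl.
(* At a crossing the chain avoids box [(a+1, b'+1)]: it starts either beyond column [b'+1] or above
   row [a+1]. At an elbow, dropping the first box [x] leaves a chain above row [a+1] and beyond
   column [b'+1]. *)
case: ifP => crx.
  have [x2|x2] := ltnP b'.+1 x.2.
    have := IHd (x :: l) sl.
    suff -> : all (elbow_in a.+1 b'.+1) (x :: l) by move=> /(_ isT); lia.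
    apply/allP => y; rewrite inE => /orP[/eqP->|yl].
      by move: ex; rewrite /elbow_in; lia.
    by have := allP sub _ yl; have := allP al _ yl; rewrite /elbow_in /ne; lia.
  have := IHa b' (x :: l) ltac:(lia) sl.
  have x1 : x.1 != a.+1.
    apply: contraTneq ex => e1; have e2 : b' < x.2 -> x.2 = b'.+1 by lia.
    apply/negP => /and3P[_ /andP[/e2 e3 _]]; rewrite e1 e3 crx //.
  suff -> : all (elbow_in a b') (x :: l) by move=> /(_ isT); lia.
  apply/allP => y; rewrite inE => /orP[/eqP->|yl].
    by move: ex; rewrite /elbow_in; lia.
  move: ex; have := allP sub _ yl; have := allP al _ yl.
  by rewrite /elbow_in /ne; lia.
have := IHa b'.+1 l ltac:(lia) sl'.
suff -> : all (elbow_in a b'.+1) l by move=> /(_ isT) /=; lia.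
apply/allP => y yl; move: ex; have := allP sub _ yl; have := allP al _ yl.
by rewrite /elbow_in /ne; lia.
Qed.

Lemma chain_ex a b : b <= q ->
  exists l, [/\ sorted ne l, all (elbow_in a b) l & b + size l = h a b].
Proof.
have weak a1 b1 a2 b2 l : a1 <= a2 -> b2 <= b1 ->
    all (elbow_in a1 b1) l -> all (elbow_in a2 b2) l.
  by move=> la lb; apply: sub_all => x; rewrite /elbow_in; lia.
elim: a b => [|a IHa] b.
  by move=> bq; exists [::]; rewrite h0 /=; split=> //; lia.
move=> bq; rewrite -(subKn bq); elim: (q - b) => [|d IHd].
  by exists [::]; rewrite subn0 h_right /=; last lia; split=> //; lia.
have [lt|le] := ltnP d q; last first.
  by rewrite (_ : q - d.+1 = q - d); [apply: IHd | ]; lia.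
set b' := q - d.+1; have eb : q - d = b'.+1 by lia.
clearbody b'.
rewrite eb in IHd; rewrite hS; last by lia.
case: ifP => crx.
  have [l1 [s1 a1 e1]] := IHd.
  have [l2 [s2 a2 e2]] := IHa b' ltac:(lia).
  have [le|lt'] := leqP (h a.+1 b'.+1).-1 (h a b').
    by exists l2; split=> //; refine (weak _ _ _ _ _ _ _ a2); lia.
  exists l1; split; [by [] | by refine (weak _ _ _ _ _ _ _ a1); lia | lia].
have [l [s al e]] := IHa b'.+1 ltac:(lia).
exists ((a.+1, b'.+1) :: l); split; last by rewrite -e /=; lia.
- rewrite /= path_min_sorted //; apply: sub_all al => y.
  by rewrite /elbow_in /ne /=; lia.
- by rewrite /= (weak _ _ _ _ _ _ _ al); rewrite /elbow_in /= ?crx; lia.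
Qed.

End Chains.

(** * Sweeping the staircase *)

Section Sweep.
Variable m : nat.
Hypothesis m_gt0 : 0 < m.

(* All the rows are swept over [m] columns: boxes outside the staircase are never
   crossings, so they do not matter.  [tau] is inverse to [box]. *)
Definition box t : nat * nat := ((t %/ m).+1, m - t %% m).
Definition tau a b : nat := a.-1 * m + (m - b).
Definition idx t : nat := ((box t).1 + (box t).2).-1.

Lemma box_tau a b : 0 < a -> 0 < b <= m -> box (tau a b) = (a, b).
Proof.
move=> a0 bm; rewrite /box /tau divnMDl // modnMDl divn_small ?modn_small; try lia.
by congr pair; lia.
Qed.

Lemma idx_tau a b : 0 < a -> 0 < b <= m -> idx (tau a b) = (a + b).-1.
Proof. by move=> a0 bm; rewrite /idx box_tau. Qed.

Lemma idx_gt0 t : 0 < idx t.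
Proof.
rewrite /idx /box addSn /=; have := ltn_pmod t m_gt0.
by move: (t %% m) (t %/ m); lia.
Qed.

Lemma sweepP a t : a * m <= t -> exists d b,
  [/\ 0 < b <= m, t = a * m + d * m + (m - b), t = tau (a + d).+1 b
    & idx t = a + d + b].
Proof.
move=> at_; have := ltn_pmod t m_gt0; have := divn_eq t m.
have : a <= t %/ m by rewrite leq_divRL.
move: (t %/ m) (t %% m) => d r /subnKC <- -> rm; exists (d - a), (m - r).
have e' : (a + (d - a)) * m + r = tau (a + (d - a)).+1 (m - r) by rewrite /tau /=; lia.
by split=> //; [lia | rewrite -mulnDl; lia | rewrite e' idx_tau; lia].
Qed.

Lemma tau_inj a b a' b' : 0 < a -> 0 < b <= m -> 0 < a' -> 0 < b' <= m ->
  tau a b = tau a' b' -> (a, b) = (a', b').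
Proof. by move=> a0 bm a0' bm' e; rewrite -(box_tau a0 bm) e box_tau. Qed.

(* After [(a+1, b+1)] is swept and until [(a+2, b)] is reached, the boundary
   path keeps the corner at the bottom right of box [(a+1, b)]. *)
Lemma idx_corner a b t : b <= m -> tau a.+1 b <= t < tau a.+2 b -> idx t != a.+1 + b.
Proof.
move=> bm; rewrite /tau /= mulSn => /andP[l1 l2].
case: (@sweepP a t ltac:(lia)) => d [b' [b'm e _ ->]].
case: d e => [|[|d]] e; rewrite ?mulSn in e; lia.
Qed.

(** * Heights at lattice points of the staircase *)

Section Heights.
Variable cr : nat -> nat -> bool.
Hypothesis cr_stair : forall a b, cr a b -> a + b <= m.
Let c t := cr (box t).1 (box t).2.
Variable c' : nat -> bool.
Hypothesis c'_dem : demazure idx c c'.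

(* Indexed by the lattice point at the bottom right corner of box [(a, b)], which
   is the [(a + b)]-th point of the boundary path when box [(a+1, b)] is reached. *)
Definition hgt q a b := cnt q (run idx c' (tau a.+1 b)) (a + b).

Lemma hgt0 q b : hgt q 0 b = minn b q.
Proof.
rewrite -cnt_id /hgt add0n.
rewrite (cnt_run_frame idx_gt0 q c'_dem (leq0n _)) //= => t tb _.
case: (@sweepP 0 t ltac:(lia)) => d [b' [b'm e _ ->]].
move: tb; rewrite /tau /= mul0n.
by case: d e => [|d] e; rewrite ?mulSn in e *; lia.
Qed.

Lemma idx_cross t : c t -> (idx t).+1 <= m.
Proof. by move/cr_stair; rewrite /idx /=; lia. Qed.

(** Every crossing exchanges two positions in [1..m], so a prefix of length at least [m] keeps its
    set of labels. *)
Lemma hgtm q a : q <= m -> hgt q a m = q.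
Proof.
move=> qm; rewrite /hgt (cnt_run_frame idx_gt0 q c'_dem (leq0n _)); last first.
  by move=> t _ /idx_cross; move: (idx t); lia.
by rewrite cnt_id; lia.
Qed.

Lemma hgtS q a b : b < m ->
  hgt q a.+1 b = if cr a.+1 b.+1 then maxn (hgt q a b) (hgt q a.+1 b.+1).-1
                 else hgt q a b.+1.
Proof.
move=> bm.
(* No exchange splits the prefix of length [a.+1 + b0] between these two times, so the height can be
   read off while row [a+1] is being swept. *)
have frame b0 : b0 <= m -> hgt q a.+1 b0 = cnt q (run idx c' (tau a.+1 b0)) (a.+1 + b0).
  move=> b0m; apply: (cnt_run_frame idx_gt0 q c'_dem).
    by rewrite /tau /=; lia.
  by move=> t tb _; rewrite eq_sym; apply: idx_corner.
rewrite frame; last by lia.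
have -> : tau a.+1 b = (tau a.+1 b.+1).+1 by rewrite /tau; lia.
have it : idx (tau a.+1 b.+1) = (a.+1 + b) by rewrite idx_tau; lia.
have ct : c (tau a.+1 b.+1) = cr a.+1 b.+1 by rewrite /c box_tau //; lia.
rewrite (cnt_run_step idx_gt0 _ _ _ c'_dem) it ct eqxx andbT.
case: ifP => crx; last by rewrite /hgt addnS addSn.
rewrite (frame b.+1) // -addnS /=; congr maxn.
rewrite /hgt.
have -> : tau a.+1 b = (tau a.+1 b.+1).+1 by rewrite /tau; lia.
rewrite (cnt_run_step idx_gt0 _ _ _ c'_dem) it.
by case: eqP => [|_]; [lia | rewrite andbF].
Qed.

(** After the first [a] rows all exchanges happen at positions beyond [a]. *)
Lemma hgt_final q a : a <= m -> hgt q a 0 = cnt q (run idx c' (m * m)) a.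
Proof.
move=> am.
have late t : a * m <= t ->
    cnt q (run idx c' t) a = cnt q (run idx c' (a * m)) a.
  move=> at_; apply: (cnt_run_frame idx_gt0 q c'_dem at_) => u /andP[au _] _.
  by case: (sweepP au) => d [b [bm _ _ ->]]; lia.
by rewrite /hgt addn0 !late ?leq_mul2r ?am ?orbT // /tau /=; lia.
Qed.

End Heights.

(** * Traced pipes as labels of the sweep *)

Section Pipes.
Variable D : {set 'I_m.+1 * 'I_m.+1}.

Definition crosses_at t := is_cross D (box t).1 (box t).2.
Notation state := (run idx crosses_at).

Lemma is_cross_le a b : is_cross D a b -> a + b <= m.
Proof. by case/andP. Qed.

Lemma crosses_at_tau a b : 0 < a -> 0 < b <= m ->
  crosses_at (tau a b) = is_cross D a b.
Proof. by move=> a0 bm; rewrite /crosses_at box_tau. Qed.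

Lemma state_range t i : 0 < i <= m -> 0 < state t i <= m.
Proof.
elim: t i => //= t IH i im; case: ifP => [/(idx_cross is_cross_le) lt|_]; apply: IH => //.
by move: lt (idx_gt0 t); rewrite /adj; case: (idx t) => // k; do ! case: ifP; lia.
Qed.

Lemma state_out t i : ~~ (0 < i <= m) -> state t i = i.
Proof.
move=> im; apply: (run_frame (leq0n t)) => u _ /(idx_cross is_cross_le) lt.
by move: lt (idx_gt0 u) im; move: (idx u); lia.
Qed.

(** Just before box [x] is swept, the positions [x.1 + x.2 - 1] and [x.1 + x.2] are its top and
    right edges: pipe [lab] passes through [x]. *)
Definition touch (x : nat * nat) lab : bool :=
  (state (tau x.1 x.2) (x.1 + x.2).-1 == lab) || (state (tau x.1 x.2) (x.1 + x.2) == lab).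

Lemma untouched_gap t1 t2 p lab :
  (forall t, t1 <= t < t2 -> (p != idx t) && (p != (idx t).+1)) ->
  state t1 p = lab ->
  forall a b, 0 < a -> 0 < b <= m -> t1 <= tau a b < t2 -> ~~ touch (a, b) lab.
Proof.
move=> gap st a b a0 bm tab; have := gap _ tab; rewrite idx_tau // prednK; last by lia.
have <- : state (tau a b) p = lab.
  rewrite -st; apply: run_frame => [|t tb _]; first by lia.
  by apply: gap; lia.
by rewrite /touch /= !(inj_eq (@run_inj _ _ _)); lia.
Qed.

Lemma gap_down a b t : 0 < a -> 0 < b <= m -> (tau a b).+1 <= t < tau a.+1 b ->
  (a + b != idx t) && (a + b != (idx t).+1).
Proof.
case: a => // a _ bm; rewrite /tau /= mulSn => /andP[l1 l2].
case: (@sweepP a t ltac:(lia)) => d [b' [b'm e _ ->]].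
by case: d e => [|[|d]] e; rewrite ?mulSn in e; lia.
Qed.

Lemma gap_exit a t : 0 < a -> (tau a 1).+1 <= t -> (a != idx t) && (a != (idx t).+1).
Proof.
case: a => // a _; rewrite /tau /= => l1.
case: (@sweepP a.+1 t _) => [|d [b' [b'm e _ ->]]]; last by lia.
by rewrite mulSn; lia.
Qed.

Definition follows t0 lab (r : seq (nat * nat) * nat) : Prop :=
  [/\ forall x, x \in r.1 -> [/\ 0 < x.1, 0 < x.2 <= m, t0 <= tau x.1 x.2 & touch x lab],
      uniq r.1,
      forall a b, 0 < a <= m -> 0 < b <= m -> t0 <= tau a b -> touch (a, b) lab ->
        (a, b) \in r.1
    & 0 < r.2 <= m /\ state (m * m) r.2 = lab].

(** The bound [m + top] admits half-tiles only for pipes coming from the top. Each move raises [a]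
    or lowers [b], which preserves the fuel bound. *)
Lemma trace_spec f a b (top : bool) lab : 0 < a -> 0 < b -> a + b <= m + top ->
  m.+1 + b <= f + a -> state (tau a b) (a + b - top) = lab ->
  follows (tau a b) lab (trace D f a b top).
Proof.
elim: f a b top => [|f IH] a b top a0 b0 abm fuel st; first by lia.
have am : a <= m by lia.
have bm : 0 < b <= m by lia.
set down := if top then is_cross D a b else ~~ is_cross D a b.
have tch : touch (a, b) lab.
  by rewrite /touch /= -st; case: (top); rewrite ?subn1 ?subn0 eqxx ?orbT.
have st1 : state (tau a b).+1 (if down then a + b else (a + b).-1) = lab.
  move: st; rewrite /= crosses_at_tau // idx_tau // /down.
  have -> : a + b - top = if top then (a + b).-1 else a + b by case: (top); lia.
  have -> : a + b = (a + b).-1.+1 by lia.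
  case: (is_cross D a b); case: (top) => //=; rewrite /adj ?eqxx //.
  by rewrite eqn_leq ltnn.
(* Prepends the current box to a trace valid from time [t2] on, provided the pipe rests at one
   position until then. *)
have step t2 r : tau a b < t2 ->
    (forall t, (tau a b).+1 <= t < t2 ->
       let p := if down then a + b else (a + b).-1 in (p != idx t) && (p != (idx t).+1)) ->
    follows t2 lab r -> follows (tau a b) lab ((a, b) :: r.1, r.2).
  move=> lt2 gap [sound un complete exit] /=; split=> //.
  - move=> x; rewrite inE => /orP[/eqP-> //|/sound[? ? ? ?]]; split=> //.
    exact: leq_trans (ltnW lt2) _.
  - by rewrite /= un andbT; apply/negP => /sound[_ _] /=; lia.
  - move=> a' b' a0' bm' le tch'; rewrite inE.
    have [le2|gt2] := leqP t2 (tau a' b'); first by rewrite complete ?orbT.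
    move: le; rewrite leq_eqVlt => /orP[/eqP e|lt].
      by rewrite (tau_inj a0 bm _ bm' e) ?eqxx //; lia.
    have a0'' : 0 < a' by lia.
    have := untouched_gap gap st1 a0'' bm'.
    by rewrite lt gt2 tch' => /(_ isT).
rewrite /= -/down; case: ifP => [dn|/negbT dn].
  have gap t : (tau a b).+1 <= t < tau a.+1 b ->
      (a + b != idx t) && (a + b != (idx t).+1) by apply: gap_down.
  have lt : tau a b < tau a.+1 b by case: (a) a0 => // a1 _; rewrite /tau /= mulSn; lia.
  apply: (step (tau a.+1 b)) => //; first by rewrite dn.
  apply: IH => //.
  - move: abm dn; rewrite /down; case: (top); last by lia.
    by move=> _ /is_cross_le; lia.
  - by lia.
  rewrite dn in st1; rewrite addSn subn1 /= -st1.
  by apply: run_frame => // t /gap.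
rewrite (negbTE dn) in st1 step.
have [b1|b1] := leqP b 1.
  have eb : b = 1 by lia.
  rewrite eb in st1 step *; rewrite addn1 succnK in st1 step.
  have tau_lt a1 b' : 0 < a1 <= m -> 0 < b' -> tau a1 b' < m * m.
    case: a1 => // a1 am' b'0.
    have : a1.+1 * m <= m * m by rewrite leq_mul2r; lia.
    by rewrite /tau mulSn /=; lia.
  apply: (step (m * m) ([::], a)); first by apply: tau_lt; lia.
    by move=> t /andP[l1 _]; apply: gap_exit.
  split=> //.
    by move=> a' b' am' /andP[b'0 _]; rewrite leqNgt tau_lt.
  split=> /=; first by lia.
  rewrite -st1; apply: run_frame; first by apply: tau_lt; lia.
  by move=> t /andP[l1 _] _; apply: gap_exit.
have e : tau a b.-1 = (tau a b).+1 by rewrite /tau; lia.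
apply: (step (tau a b.-1)); rewrite e //; first by lia.
rewrite -e; apply: IH; try lia.
by rewrite e -st1; congr (state _ _); rewrite /=; lia.
Qed.

Lemma pipe_spec lab : 0 < lab <= m ->
  [/\ forall x, x \in (pipe D lab).1 -> [/\ 0 < x.1, 0 < x.2 <= m & touch x lab],
      uniq (pipe D lab).1,
      forall a b, 0 < a <= m -> 0 < b <= m -> touch (a, b) lab -> (a, b) \in (pipe D lab).1
    & 0 < (pipe D lab).2 <= m /\ state (m * m) (pipe D lab).2 = lab].
Proof.
move=> labm; have gap t : 0 <= t < tau 1 lab -> (lab != idx t) && (lab != (idx t).+1).
  move=> tb; case: (@sweepP 0 t (leq0n _)) => d [b [bm e _ ->]].
  by move: tb; rewrite /tau /= mul0n; case: d e => [|d] e; rewrite ?mulSn in e *; lia.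
have st : state (tau 1 lab) (1 + lab - true) = lab.
  rewrite addKn (@run_frame _ _ 0 _ _ (leq0n _)) // => t tb _; exact: gap.
have [sound un complete exit] :=
  @trace_spec (2 * m + 2) 1 lab true lab isT ltac:(lia) ltac:(lia) ltac:(lia) st.
split=> //; first by move=> x /sound[].
move=> a b am bm tch; have [le|gt] := leqP (tau 1 lab) (tau a b); first exact: complete.
have := @untouched_gap 0 _ lab lab gap erefl a b ltac:(lia) bm gt.
by rewrite tch.
Qed.

(* If two pipes meet in decreasing order, they have crossed before. *)
Lemma reduced_sorted : reduced D -> sorted_run idx crosses_at.
Proof.
move=> red t ct; rewrite ltnNge leq_eqVlt; apply/negP => /orP[/eqP/run_inj|]; first by lia.
move=> inv; have [t0 lt0 [ct0 met]] := inverted_met (ltnSn (idx t)) inv.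
set u := state t (idx t).+1 in inv met; set v := state t (idx t) in inv met.
have real t1 : crosses_at t1 -> exists a b, [/\ 0 < a <= m, 0 < b <= m,
    is_cross D a b & t1 = tau a b].
  move=> ct1; case: (@sweepP 0 t1 (leq0n _)) => d [b [bm _ e _]].
  move: ct1; rewrite e crosses_at_tau // => cr.
  by exists d.+1, b; split=> //; have := is_cross_le cr; lia.
have [a [b [am bm cr e]]] := real _ ct.
have [a0 [b0 [am0 bm0 cr0 e0]]] := real _ ct0.
have iab : idx t = (a + b).-1 by rewrite e idx_tau //; lia.
have iab0 : idx t0 = (a0 + b0).-1 by rewrite e0 idx_tau //; lia.
have iabm := is_cross_le cr.
have ur : 0 < u <= m by apply: state_range; lia.
have vr : 0 < v <= m by apply: state_range; lia.
have [_ _ cu _] := pipe_spec ur; have [_ uv cv _] := pipe_spec vr.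
have sab : (a + b).-1.+1 = a + b by lia.
have sab0 : (a0 + b0).-1.+1 = a0 + b0 by lia.
have tu : touch (a, b) u by rewrite /touch /= -e /u iab sab eqxx orbT.
have tv : touch (a, b) v by rewrite /touch /= -e /v iab eqxx.
have [tu0 tv0] : touch (a0, b0) u /\ touch (a0, b0) v.
  rewrite iab0 sab0 in met.
  by rewrite /touch /= -e0; case: met => [[-> ->]|[-> ->]]; rewrite !eqxx ?orbT.
have neq : v != u by move: inv; lia.
have := red v u vr ur neq; rewrite leqNgt => /negP; apply.
rewrite -size_filter.
have -> : 1 = (size [:: (a, b); (a0, b0)]).-1 by [].
rewrite prednK //; apply: uniq_leq_size.
  rewrite /= inE andbT; apply/eqP => - [ea eb]; move: lt0; rewrite e e0 ea eb; lia.
move=> x; rewrite !inE mem_filter => /orP[] /eqP -> /=.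
  by rewrite cr cu ?cv.
by rewrite cr0 cu ?cv.
Qed.

(** After a first crossing two pipes stay inverted, whereas a second one would need them in
    increasing order. *)
Lemma sorted_reduced : sorted_run idx crosses_at -> reduced D.
Proof.
move=> srt c1 c2 c1m c2m neq.
have [sd1 un1 _ _] := pipe_spec c1m; have [sd2 _ _ _] := pipe_spec c2m.
set P := fun x => _; rewrite leqNgt; apply/negP; rewrite -size_filter => gt.
have once x y u v : u < v -> is_cross D x.1 x.2 -> is_cross D y.1 y.2 ->
    0 < x.1 -> 0 < x.2 <= m -> 0 < y.1 -> 0 < y.2 <= m ->
    touch x u -> touch x v -> touch y u -> touch y v ->
    tau x.1 x.2 < tau y.1 y.2 -> False.
  case: x y => [a b] [a' b'] /= uv cr cr' a0 bm a0' bm' xu xv yu yv lt.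
  have local a1 b1 : is_cross D a1 b1 -> 0 < a1 -> 0 < b1 <= m ->
      touch (a1, b1) u -> touch (a1, b1) v ->
      state (tau a1 b1) (a1 + b1).-1 = u /\ state (tau a1 b1) (a1 + b1) = v.
    move=> cr1 a10 b1m; have := srt (tau a1 b1).
    rewrite crosses_at_tau // idx_tau // prednK; last by lia.
    move=> /(_ cr1) s1; rewrite /touch /= => /orP[]/eqP e1 /orP[]/eqP e2; split=> //; lia.
  have [xu' xv'] := local _ _ cr a0 bm xu xv.
  have [yu' yv'] := local _ _ cr' a0' bm' yu yv.
  have sab : (a + b).-1.+1 = a + b by lia.
  have s1 : state (tau a b).+1 (a + b).-1 = v /\ state (tau a b).+1 (a + b) = u.
    rewrite /= crosses_at_tau // cr idx_tau // /= /adj sab !eqxx; split=> //.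
    by case: eqP => //; lia.
  have [] := @inverted_stays idx crosses_at (tau a b).+1 (tau a' b') (a + b).-1 (a + b)
    srt lt ltac:(lia) ltac:(lia).
  move=> i [j [ij]]; rewrite s1.1 s1.2 -yu' -yv' => /run_inj ei /run_inj ej; lia.
case E: (filter _ _) gt => [|x [|y l]] //= _.
have := filter_uniq P un1; rewrite E /= inE negb_or => /andP[/andP[nxy _] _].
have : x \in [seq x <- (pipe D c1).1 | P x] by rewrite E inE eqxx.
have : y \in [seq x <- (pipe D c1).1 | P x] by rewrite E !inE eqxx orbT.
rewrite !mem_filter => /andP[/andP[cry y2] y1] /andP[/andP[crx x2] x1].
have [x10 x20 tx1] := sd1 _ x1; have [y10 y20 ty1] := sd1 _ y1.
have [_ _ tx2] := sd2 _ x2; have [_ _ ty2] := sd2 _ y2.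
have: tau x.1 x.2 != tau y.1 y.2.
  apply: contra nxy => /eqP /(tau_inj x10 x20 y10 y20).
  by rewrite -!surjective_pairing => ->.
rewrite !neq_ltn in neq *.
by case/orP: neq => lt /orP[] ltt; [apply: (once x y c1 c2) | apply: (once y x c1 c2)
  | apply: (once x y c2 c1) | apply: (once y x c2 c1)].
Qed.

Lemma has_permP p : {in [pred a | 0 < a <= m] &, injective p} ->
  {in [pred a | 0 < a <= m], forall a, 0 < p a <= m} ->
  has_perm D p <-> (forall a, 0 < a <= m -> state (m * m) a = p a).
Proof.
move=> pinj prange; split=> [hp a am | hs a c am cm].
  have pam := prange a am; have [_ _ _ [_ <-]] := pipe_spec pam.
  by congr (state _ _); apply/esym/(hp _ _ am pam).
have [_ _ _ [exm ex]] := pipe_spec cm; split=> [<-|pa]; first by rewrite -hs.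
by apply: pinj => //; rewrite -hs // ex.
Qed.

Lemma state_surj c : 0 < c <= m -> exists2 a, 0 < a <= m & state (m * m) a = c.
Proof. by case/pipe_spec=> _ _ _ [? ?]; exists (pipe D c).2. Qed.

End Pipes.
End Sweep.

Lemma path_ne_gap x l : path ne x l ->
  x.2 + size l <= (last x l).2 /\ (last x l).1 + size l <= x.1.
Proof.
elim: l x => [|y l IH] x /=; first by lia.
by case/andP=> /andP[? ?] /IH[]; lia.
Qed.

Lemma chain_diagonal a q l x : sorted ne l ->
  (forall y, y \in l -> 0 < y.1 <= a /\ 0 < y.2 <= q) ->
  x \in l -> size l < x.1 + x.2 /\ x.1 + x.2 + size l <= (a + q).+1.
Proof.
case: l => // h t /= pt inr xt; case/splitPl: xt pt inr => p1 p2 ex.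
rewrite cat_path ex => /andP[p_h p_x] inr.
have [] := path_ne_gap p_h; have [] := path_ne_gap p_x; rewrite ex.
have [] := inr h (mem_head _ _).
have [] := inr (last x p2).
  by rewrite -ex -last_cat; apply: mem_last.
by rewrite /= size_cat; lia.
Qed.

Lemma pairwise_mem2 (A : eqType) (r : rel A) s x y :
  pairwise r s -> x \in s -> y \in s -> x != y -> r x y || r y x.
Proof.
elim: s => //= z s IH /andP[/allP rz ps]; rewrite !inE.
case/orP=> [/eqP-> | xs] /orP[/eqP-> | ys] nxy; rewrite ?eqxx // in nxy *.
- by rewrite rz.
- by rewrite orbC rz.
- exact: IH.
Qed.

Lemma cnt_mono q s i j : i <= j -> cnt q s i <= cnt q s j.
Proof.
move=> /subnKC <-; elim: (j - i) => [|d IH]; first by rewrite addn0.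
by rewrite addnS cntS; lia.
Qed.

Lemma is_crossE m (D : {set 'I_m.+1 * 'I_m.+1}) (a b : 'I_m.+1) :
  is_cross D a b = (a + b <= m) && ((a, b) \in D).
Proof.
rewrite /is_cross; congr andb; apply/existsP/idP => [|abD].
  by case=> -[a' b'] /= /and3P[abD /eqP/val_inj <- /eqP/val_inj <-].
by exists (a, b); rewrite abD !eqxx.
Qed.

Lemma is_cross_inord m (D : {set 'I_m.+1 * 'I_m.+1}) a b : a <= m -> b <= m ->
  is_cross D a b = (a + b <= m) && ((inord a, inord b) \in D).
Proof. by move=> am bm; have := is_crossE D (inord a) (inord b); rewrite !inordK. Qed.

(** * Crossing-free sets and reduced pipe dreams *)

Section Bijection.
Variables n k : nat.
Hypotheses (hk : 1 <= k) (hn : 2 * k + 1 <= n).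
Local Notation m := (n - k).

Lemma m_gt0 : 0 < m.
Proof. by lia. Qed.

Local Notation box := (box m).
Local Notation tau := (tau m).
Local Notation idx := (idx m).
Implicit Types (D : {set 'I_m.+1 * 'I_m.+1}) (T : {set 'I_n.+1 * 'I_n.+1}).

Lemma rpdP D : reduced_pipe_dream_for D (pi_nk n k) <->
  [/\ D \subset staircase m, sorted_run idx (crosses_at D) &
      forall a, 0 < a <= m -> run idx (crosses_at D) (m * m) a = pi_nk n k a].
Proof.
have m0 := m_gt0.
have hp : has_perm D (pi_nk n k) <->
    forall a, 0 < a <= m -> run idx (crosses_at D) (m * m) a = pi_nk n k a.
  apply: has_permP => //.
    by move=> a b; rewrite !inE /pi_nk; do ! case: ifP; lia.
  by move=> a; rewrite !inE /pi_nk; case: ifP; lia.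
split=> [[sub red /hp perm]|[sub srt /hp perm]]; split=> //.
  exact: reduced_sorted.
exact: sorted_reduced.
Qed.

Lemma crosses_at_early D t : crosses_at D t -> t < m * m.
Proof.
have m0 := m_gt0.
case: (@sweepP m m0 0 t (leq0n _)) => d [b [bm et e _]].
rewrite e crosses_at_tau // => /is_cross_le lt; rewrite -e et.
have : d.+1 * m <= m * m by rewrite leq_mul2r; lia.
by rewrite mulSn; lia.
Qed.

(* An exchange at a position [<= k] would move some label [<= k] behind a larger
   one for good, which the permutation [pi_nk n k] does not allow. *)
Lemma rpd_idx D t : reduced_pipe_dream_for D (pi_nk n k) -> crosses_at D t -> k < idx t.
Proof.
case/rpdP=> _ srt fin; have m0 := m_gt0; have km : k < m by lia.
have low u : (forall i, i <= k -> run idx (crosses_at D) u i = i) ->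
    crosses_at D u -> k < idx u.
  move=> fixed cu; rewrite ltnNge; apply/negP => le.
  have iu0 := idx_gt0 m0 u.
  have := srt _ cu; rewrite (fixed (idx u)) // => lt.
  have [eh ev] : run idx (crosses_at D) u.+1 (idx u) = run idx (crosses_at D) u (idx u).+1 /\
      run idx (crosses_at D) u.+1 (idx u).+1 = idx u.
    rewrite /= cu /= /adj !eqxx eqn_leq ltnn /=; split=> //; exact: fixed.
  have [] := inverted_stays srt (crosses_at_early cu) (ltnSn (idx u)); first by rewrite eh ev.
  move=> i [j []]; rewrite eh ev => ij ei ej.
  have h_r : 0 < run idx (crosses_at D) u (idx u).+1 <= m.
    by apply: state_range => //; lia.
  have [i' i'm ei'] := state_surj m0 D h_r.
  have [j' j'm ej'] : exists2 a, 0 < a <= m & run idx (crosses_at D) (m * m) a = idx u.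
    by apply: state_surj => //; lia.
  have ii' : i = i' by apply: (@run_inj idx (crosses_at D) (m * m)); rewrite ei ei'.
  have jj' : j = j' by apply: (@run_inj idx (crosses_at D) (m * m)); rewrite ej ej'.
  move: ei' ej'; rewrite !fin // -ii' -jj' /pi_nk; move: i'm j'm; rewrite -ii' -jj'.
  by move: lt le; rewrite /pi_nk; do ! case: ifP; lia.
suff fixed u i : i <= k -> run idx (crosses_at D) u i = i by apply: low => i; apply: fixed.
elim: u i => //= u IH i ik; case: ifP => [/(low _ IH) lt|_]; last exact: IH.
by rewrite /= /adj !ifF ?IH //; apply/eqP; lia.
Qed.

Lemma is_cross_phi T a b : is_cross (phi n k T) a b =
  [&& in_staircase m a b, k.+2 <= a + b & ~~ in_T T (box_diag n a b)].
Proof.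
have [abm|abm] := boolP (in_staircase m a b); last first.
  apply/negP => /andP[_ /existsP[x /and3P[]]].
  by rewrite inE => /and3P[xs _ _] /eqP e1 /eqP e2; rewrite -e1 -e2 xs in abm.
have am : a < (n - k).+1 by move: abm; rewrite /in_staircase; lia.
have bm : b < (n - k).+1 by move: abm; rewrite /in_staircase; lia.
rewrite is_cross_inord // inE /= !inordK // abm.
by move: abm; rewrite /in_staircase /in_Gamma /=; case: (in_T _ _); lia.
Qed.

Lemma in_TE T (e : 'I_n.+1 * 'I_n.+1) : in_T T (dval e) = (e \in T).
Proof.
apply/existsP/idP => [[f /andP[fT /eqP]]|eT]; last by exists e; rewrite eT eqxx.
by case: e f fT => [e1 e2] [f1 f2] /= fT [/val_inj <- /val_inj <-].
Qed.

(** The inverse of [phi] on reduced pipe dreams. *)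
Definition elbows D : {set 'I_n.+1 * 'I_n.+1} :=
  [set e in Gamma n k | ~~ is_cross D (n.+1 - e.2) e.1].

Lemma elbows_phi T : T \subset Gamma n k -> elbows (phi n k T) = T.
Proof.
move=> /subsetP sub; apply/setP => e; rewrite !inE is_cross_phi.
have eg : e \in Gamma n k -> [/\ in_staircase m (n.+1 - e.2) e.1,
    k.+2 <= n.+1 - e.2 + e.1 & box_diag n (n.+1 - e.2) e.1 = dval e].
  rewrite inE /in_Gamma /in_staircase /box_diag /dval /=.
  by split; [lia | lia | congr pair; lia].
have := eg; have := sub e; rewrite inE; case: (in_Gamma _ _ _) => /=; last first.
  by case: (e \in T) => // /(_ isT).
by move=> _ /(_ isT) [-> -> ->]; rewrite in_TE negbK.
Qed.

(** By [rpd_idx] every crossing tile has [a + b >= k + 2], hence is the box of a diagonal in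
    [Gamma]. *)
Lemma phi_elbows D : reduced_pipe_dream_for D (pi_nk n k) -> phi n k (elbows D) = D.
Proof.
move=> rD; have [/subsetP sub _ _] := rD; apply/setP => -[a b].
apply/idP/idP => [|abD].
  rewrite inE -[(a, b).1]/a -[(a, b).2]/b => /and3P[xs xg]; apply: contraNT => nxD.
  have [a1 b1 abm] := and3P xs.
  pose e : 'I_n.+1 * 'I_n.+1 := (inord b, inord (n.+1 - a)).
  have ex : dval e = box_diag n a b.
    by rewrite /dval /box_diag /= !inordK //; lia.
  rewrite -ex in_TE inE inE ex xg /= !inordK; try lia.
  by rewrite subKn ?is_crossE ?(negbTE nxD) ?andbF //; lia.
have xs := sub _ abD; rewrite inE /= in xs.
have [a1 b1 abm] := and3P xs; have m0 := m_gt0.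
have cr : is_cross D a b by rewrite is_crossE abD abm.
have := @rpd_idx D (tau a b) rD.
rewrite crosses_at_tau // ?idx_tau //; try by lia.
move=> /(_ cr) lt; rewrite inE /= xs /=; apply/andP; split.
  by rewrite /in_Gamma /box_diag /=; lia.
apply/negP => /existsP[e /andP[+ /eqP ex]]; rewrite inE => /andP[_ /negP]; apply.
by move: ex; rewrite /dval /box_diag => -[-> ->]; rewrite subKn //; lia.
Qed.

Lemma rpd_unique D1 D2 : reduced_pipe_dream_for D1 (pi_nk n k) ->
  reduced_pipe_dream_for D2 (pi_nk n k) -> D1 \subset D2 -> D1 = D2.
Proof.
move=> /rpdP[sub1 srt1 fin1] /rpdP[sub2 srt2 fin2] /subsetP sub; have m0 := m_gt0.
have subc t : crosses_at D1 t -> crosses_at D2 t.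
  case/andP=> le /existsP[x /andP[xD H]].
  by apply/andP; split=> //; apply/existsP; exists x; rewrite sub.
apply/setP => -[a b]; apply/idP/idP => [/sub //|abD].
have := subsetP sub2 _ abD; rewrite inE /= => /and3P[a1 b1 abm].
have cE : crosses_at D1 (tau a b) = crosses_at D2 (tau a b).
  apply: (sorted_run_unique (idx_gt0 m0) srt1 srt2 subc (N := m * m)).
    move=> i; have [im|im] := boolP (0 < i <= m); first by rewrite fin1 // fin2.
    by rewrite !state_out.
  by apply: (@crosses_at_early D2); rewrite crosses_at_tau ?is_crossE ?abD ?andbT //; lia.
move: cE; rewrite !crosses_at_tau //; try lia.
by rewrite !is_crossE abD abm /= => ->.
Qed.

(** Sorted by first endpoint, mutually crossing diagonals also have increasing second endpoints,
    i.e. decreasing rows. *)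
Lemma crossing_chain (S : {set 'I_n.+1 * 'I_n.+1}) l :
  is_crossing l S -> sorted ne [seq (n.+1 - val e.2, val e.1)
    | e <- sort (fun e f : 'I_n.+1 * 'I_n.+1 => e.1 <= f.1) (enum S)].
Proof.
case=> _ crS; set leS := (X in sort X _); rewrite sorted_map.
have srt : pairwise leS (sort leS (enum S)).
  rewrite -sorted_pairwise; last by move=> y x z; apply: leq_trans.
  by apply: sort_sorted => x y; apply: leq_total.
have un : uniq (sort leS (enum S)) by rewrite sort_uniq enum_uniq.
apply: pairwise_sorted; move: un; rewrite uniq_pairwise => un.
have pw : pairwise [rel x y | leS x y && (x != y)] (sort leS (enum S)).
  by rewrite (pairwise_relI leS (fun x y => x != y)) srt.
refine (@sub_in_pairwise _ (mem S) _ _ _ _ _ pw); last first.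
  by apply/allP => e; rewrite mem_sort mem_enum.
move=> [i j] [i' j'] eS fS /= /andP[le neq]; have := crS _ _ eS fS neq.
by move: le; rewrite /cross /ne /leS /=; have := ltn_ord j; have := ltn_ord j'; lia.
Qed.

(** A label above [k] within the first [a] positions is at least [n + 1 - a > q]. *)
Lemma cnt_pi q a : a + q <= n -> cnt q (pi_nk n k) a <= minn a k.
Proof.
elim: a => [|a IH] aq; first by rewrite cnt0.
by rewrite cntS; have := IH ltac:(lia); rewrite /pi_nk; case: ifP; lia.
Qed.

Lemma elbows_crossing_free D :
  reduced_pipe_dream_for D (pi_nk n k) -> crossing_free k (elbows D).
Proof.
move=> rD S /subsetP sub crS; have [cardS cr] := crS; have m0 := m_gt0.
have [_ srt fin] := (rpdP D).1 rD.
have [e0 e0S] : exists e, e \in S by apply/set0Pn; rewrite -card_gt0 cardS.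
(* Let [q] be the largest first endpoint. All diagonals of [S] cross [(q, r)] or equal it, so they
   end beyond [q]: their boxes lie in columns up to [q] and rows up to [n - q]. *)
case: (arg_maxnP (fun e : 'I_n.+1 * 'I_n.+1 => val e.1) e0S) => -[q r] fS fmax.
set L := [seq (n.+1 - val e.2, val e.1)
  | e <- sort (fun e f : 'I_n.+1 * 'I_n.+1 => e.1 <= f.1) (enum S)].
have gam i j : (i, j) \in S -> in_Gamma n k (val i, val j) /\ ~~ is_cross D (n.+1 - j) i.
  by move=> /sub; rewrite !inE => /andP[].
have [fg _] := gam q r fS.
have qm : q <= m by move: fg; rewrite /in_Gamma /=; lia.
have sL : sorted ne L by apply: crossing_chain crS.
have aL : all (elbow_in q (is_cross D) (minn (n - q) m) 0) L.
  apply/allP => x /mapP[[i j]]; rewrite mem_sort mem_enum => eS -> {x}.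
  have [eg ncr] := gam i j eS; rewrite /elbow_in /= ncr.
  have := fmax (i, j) eS; move: eg; rewrite /in_Gamma /=.
  suff : q < j by lia.
  have [[_ ->]|neq] := (i, j) =P (q, r); first by move: fg; rewrite /in_Gamma /=; lia.
  have := cr _ _ eS fS (introN eqP neq); have := fmax _ eS; rewrite /cross /=.
  by move: fg; rewrite /in_Gamma /=; lia.
have := chain_le qm (hgt0 m0 (sorted_demazure srt) q)
  (fun a => hgtm m0 (@is_cross_le m D) (sorted_demazure srt) a qm)
  (hgtS m0 (sorted_demazure srt) q) (leq0n q) sL aL.
rewrite (hgt_final m0 (sorted_demazure srt)) //; last by lia.
have sz : size L = k.+1 by rewrite size_map size_sort -cardE.
rewrite sz (@eq_cnt q _ (pi_nk n k)); last by move=> i ir; apply: fin; lia.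
have := @cnt_pi q (minn (n - q) m) ltac:(lia); lia.
Qed.

(** For exactly [k + 1] boxes, [chain_diagonal] gives [k + 2 <= x.1 + x.2 <= n - k], so these elbows
    are diagonals of [T]; as [a + q <= n], they mutually cross. *)
Lemma crossing_free_chain T a q l : crossing_free k T -> a + q <= n ->
  sorted ne l -> all (elbow_in q (is_cross (phi n k T)) a 0) l -> size l <= k.
Proof.
move=> cfT aq sl al; rewrite leqNgt; apply/negP => kl.
set l0 := take k.+1 l.
have sz : size l0 = k.+1 by rewrite size_takel.
have s0 : sorted ne l0 by apply: take_sorted.
have in0 x : x \in l0 -> elbow_in q (is_cross (phi n k T)) a 0 x.
  by move=> /mem_take; apply: (allP al).
have rng x : x \in l0 -> 0 < x.1 <= a /\ 0 < x.2 <= q.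
  by move=> /in0/and3P[].
pose g (x : nat * nat) : 'I_n.+1 * 'I_n.+1 := (inord x.2, inord (n.+1 - x.1)).
have gE x : x \in l0 -> dval (g x) = (x.2, n.+1 - x.1).
  by case: x => x1 x2 /rng /= [? ?]; rewrite /dval /g /= !inordK //; lia.
have un : uniq l0.
  have ne_irr : irreflexive ne by move=> x; rewrite /ne ltnn.
  exact: (sorted_uniq ne_trans ne_irr) s0.
have ung : uniq (map g l0).
  rewrite map_inj_in_uniq // => -[x1 x2] [y1 y2] xl yl e.
  have := gE _ xl; rewrite e (gE _ yl) => -[e2 e1].
  by have /= := rng _ xl; have /= := rng _ yl; move=> ? ?; congr pair; lia.
apply: (cfT [set e in map g l0]).
  apply/subsetP => e; rewrite inE => /mapP[[x1 x2] xl ->]; rewrite -in_TE gE //.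
  have [] := chain_diagonal s0 rng xl; rewrite sz /= => d1 d2.
  have /= [r1 r2] := rng _ xl; have /and3P[_ _] := in0 _ xl.
  rewrite is_cross_phi /in_staircase /box_diag /=; case: (in_T _ _) => //.
  by rewrite !andbT; lia.
split; first by rewrite cardsE (card_uniqP ung) size_map.
move=> e f; rewrite !inE => /mapP[[x1 x2] xl ->] /mapP[[y1 y2] yl ->] neq.
have nxy : (x1, x2) != (y1, y2) by apply: contraNneq neq => ->.
have pw : pairwise ne l0 by rewrite -sorted_pairwise //; exact: ne_trans.
have := pairwise_mem2 pw xl yl nxy; rewrite !gE // /ne /cross /=.
by have /= [? ?] := rng _ xl; have /= [? ?] := rng _ yl; lia.
Qed.

Lemma crossing_free_reduced T : crossing_free k T ->
  exists2 D : {set 'I_m.+1 * 'I_m.+1}, D \subset phi n k T & reduced_pipe_dream_for D (pi_nk n k).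
Proof.
move=> cfT; have m0 := m_gt0; set P := phi n k T.
have dc := dem_demazure idx (crosses_at P); set c := dem _ _ in dc.
pose D := [set x in P | c (tau x.1 x.2)].
have sub : D \subset P by apply/subsetP => x; rewrite inE => /andP[].
have cD : crosses_at D =1 c.
  move=> t; case: (@sweepP m m0 0 t (leq0n _)) => d [b [bm _ -> _]].
  rewrite crosses_at_tau // add0n.
  have [abm|abm] := leqP (d.+1 + b) m; last first.
    rewrite dc crosses_at_tau // /is_cross leqNgt abm //.
  rewrite is_cross_inord ?abm /= ?[_ \in D]in_set; try lia.
  rewrite /= !inordK; try lia.
  rewrite dc crosses_at_tau // is_cross_inord ?abm; try lia.
  by rewrite /= andbA andbb.
exists D => //; apply/rpdP.
have runE t : run idx (crosses_at D) t = run idx c t by apply: run_eq.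
split.
- by apply: subset_trans sub _; apply/subsetP => x; rewrite !inE => /and3P[].
- by move=> t; rewrite cD runE; apply: demazure_sorted dc t.
set w := run idx (crosses_at D) (m * m).
have low i : i <= k -> w i = i.
  move=> ik; apply: (run_frame (leq0n (m * m))) => t _; rewrite cD dc => /andP[ct _].
  suff: k < idx t by move: (idx t); lia.
  move: ct; case: (@sweepP m m0 0 t (leq0n _)) => d [b [bm _ -> _]].
  by rewrite crosses_at_tau // is_cross_phi idx_tau // => /and3P[_]; lia.
(* Otherwise the first [a] positions would hold [k + 1] labels up to [q = n - a], namely [1..k] and
   [w a], giving a chain of [k + 1] elbows. *)
have high a : k < a <= m -> n - a < w a.
  move=> am; rewrite ltnNge; apply/negP => wa; set q := n - a in wa.
  have qm : q <= m by lia.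
  have [l [sl al e]] := chain_ex qm (hgt0 m0 dc q)
    (fun a => hgtm m0 (@is_cross_le m P) dc a qm) (hgtS m0 dc q) a (leq0n q).
  have := @crossing_free_chain T a q l cfT ltac:(lia) sl al.
  move: e; rewrite (hgt_final m0 dc) //; last by lia.
  rewrite add0n -runE -/w => ->.
  have -> : a = a.-1.+1 by lia.
  rewrite cntS prednK ?wa; last by lia.
  have := @cnt_mono q w k a.-1 ltac:(lia).
  rewrite (@eq_cnt q w id k) ?cnt_id; first by lia.
  by move=> i ik; apply: low; lia.
have surj c0 : 0 < c0 <= m -> exists2 a, 0 < a <= m & w a = c0 by apply: state_surj.
have w_inj : injective w by apply: run_inj.
(* By [high], label [k + 1 + d] sits at a position at least [m - d], and the later positions are
   taken by smaller labels. *)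
have top d : d < m - k -> w (m - d) = k.+1 + d.
  elim/ltn_ind: d => d IH dm.
  have [a am wa] := surj (k.+1 + d) ltac:(lia).
  have [ak|ak] := leqP a k; first by move: wa; rewrite low //; lia.
  have := high a ltac:(lia); rewrite wa => da.
  have [->|neq] := eqVneq (m - d) a; first by [].
  by have := IH (m - a) ltac:(lia) ltac:(lia); rewrite subKn; [lia | lia].
move=> a am; rewrite /pi_nk; case: leqP => ak; first exact: low.
by have := top (m - a) ltac:(lia); rewrite subKn; lia.
Qed.

End Bijection.
Arguments elbows n k D : clear implicits.

Theorem theorem3p2 (n k : nat) (hk : 1 <= k) (hn : 2 * k + 1 <= n) :
  (* the identification of Gamma_{n,k} with boxes k+2 <= a+b <= m *)
  (forall a b, in_staircase (n - k) a b ->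
     (in_Gamma n k (box_diag n a b) <-> k.+2 <= a + b)) /\
  (forall i j, in_Gamma n k (i, j) ->
     in_staircase (n - k) (n.+1 - j) i /\ box_diag n (n.+1 - j) i = (i, j)) /\
  (* the map T |-> phi T is a bijection onto reduced pipe dreams for pi_{n,k} *)
  (forall T, k_triangulation n k T ->
     reduced_pipe_dream_for (phi n k T) (pi_nk n k)) /\
  (forall T1 T2, k_triangulation n k T1 -> k_triangulation n k T2 ->
     phi n k T1 = phi n k T2 -> T1 = T2) /\
  (forall D : {set 'I_(n - k).+1 * 'I_(n - k).+1},
     reduced_pipe_dream_for D (pi_nk n k) ->
     exists T, k_triangulation n k T /\ phi n k T = D).
Proof.
have elbowsS (D1 D2 : {set 'I_(n - k).+1 * 'I_(n - k).+1}) :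
    D1 \subset D2 -> elbows n k D2 \subset elbows n k D1.
  move=> /subsetP sub; apply/subsetP => e; rewrite !inE => /andP[-> /=].
  apply: contra => /andP[le /existsP[x /andP[xD H]]].
  by apply/andP; split=> //; apply/existsP; exists x; rewrite sub.
have elbows_Gamma (D : {set 'I_(n - k).+1 * 'I_(n - k).+1}) :
    elbows n k D \subset Gamma n k by apply/subsetP => e; rewrite inE => /andP[].
split.
  move=> a b; rewrite /in_staircase /in_Gamma /box_diag; split; lia.
split.
  move=> i j; rewrite /in_staircase /in_Gamma /box_diag => g.
  by split; [lia | congr pair; lia].
split.
  move=> T [TG cfT maxT]; have [D sub rD] := crossing_free_reduced hk hn cfT.
  (* [D] has at most the crossings of [phi n k T], so its elbows contain [T] and maximality
     applies. *)
  have TE : elbows n k D = T.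
    apply: maxT (elbows_Gamma D) (elbows_crossing_free hk hn rD).
    by rewrite -{1}(elbows_phi hk hn TG); apply: elbowsS.
  by rewrite -TE phi_elbows.
split.
  move=> T1 T2 [G1 _ _] [G2 _ _] e.
  by rewrite -(elbows_phi hk hn G1) e elbows_phi.
move=> D rD; exists (elbows n k D); split; last exact: phi_elbows.
split=> // [|T' sub TG cfT]; first exact: elbows_crossing_free.
have [D' sub' rD'] := crossing_free_reduced hk hn cfT.
(* A larger [T'] has fewer crossings, yet these contain a reduced pipe dream [D']; uniqueness
   squeezes [phi n k T'] between [D' = D] and [D]. *)
have sD : phi n k T' \subset D.
  rewrite -(phi_elbows hk hn rD); apply/subsetP => x; rewrite !inE.
  case/and3P=> -> -> /=; apply: contra => /existsP[e /andP[eD ex]].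
  by apply/existsP; exists e; rewrite (subsetP sub).
have DE := rpd_unique hk hn rD' rD (subset_trans sub' sD).
rewrite -(elbows_phi hk hn TG); congr elbows.
by apply/eqP; rewrite eqEsubset sD -{1}DE.
Qed.
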